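(* For every partition $\lambda=(\lambda_1,\dots,\lambda_r)$ and every flagging $f=(f_1,\dots,f_r)$ of $\lambda$, one has $$G_{\lambda,f}(x)=\widetilde{G}_{\lambda,f}(x),$$ that is, $$\sum_{T\in FSVT(\lambda,f)}\beta^{|T|-|\lambda|}\prod_{k\in T}x_k=\det\left(\sum_{s=0}^{\infty}\binom{i-j}{s}\beta^s\,G^{[f_i]}_{\lambda_i+j-i+s}(x)\right)_{1\le i,j\le r}.$$ In particular, $\widetilde{G}_{\lambda,f}(x)$ is a polynomial in $x$.
   Context: A partition $\lambda=(\lambda_1\ge\cdots\ge\lambda_r)$ is a weakly decreasing finite sequence of positive integers; $r$ is its length; it is identified with its Young diagram $\{(i,j): 1\le i\le r,\ 1\le j\le\lambda_i\}$ (English notation, $i$ is the row), and $|\lambda|$ is its number of boxes. A flagging of $\lambda$ is a weakly increasing sequence $f=(f_1,\dots,f_r)$ of positive integers. Standing assumption: if $r>1$ and $f_1=1$ then $f_2>1$. A flagged set-valued tableau of shape $\lambda$ with flagging $f$ is a filling $T$ of the boxes of $\lambda$ in which the box $(i,j)$ is filled by a non-empty subset of $\{1,\dots,f_i\}$, such that the maximum at $(i,j)$ is at most the minimum at $(i,j+1)$ whenever $j+1\le\lambda_i$, and is strictly less than the minimum at $(i+1,j)$ whenever $j\le\lambda_{i+1}$. $FSVT(\lambda,f)$ is the set of all of these. $|T|$ is the total number of entries of $T$, and $\prod_{k\in T}$ runs over all entries of $T$ (over all boxes, with multiplicity). $x=(x_1,x_2,\dots)$ are infinitely many variables; computations take place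 in the ring $\mathbb{Z}[\beta][[x]]$ of formal power series. Define $G_{\lambda,f}(x)=\sum_{T\in FSVT(\lambda,f)}\beta^{|T|-|\lambda|}\prod_{k\in T}x_k$. For an integer $p\ge1$ and $m\in\mathbb{Z}$, $G_m^{[p]}(x)\in\mathbb{Z}[\beta][[x]]$ is defined by $$\sum_{m\in\mathbb{Z}}G_m^{[p]}(x)u^m=\frac{1}{1+\beta u^{-1}}\prod_{1\le i\le p}\frac{1+\beta x_i}{1-x_iu},$$ where $\frac1{1+\beta u^{-1}}$ is expanded in powers of $u^{-1}$ and $\frac{1}{1-x_iu}$ in powers of $u$. Define $$\widetilde{G}_{\lambda,f}(x)=\det\left(\sum_{s=0}^{\infty}\binom{i-j}{s}\beta^sG^{[f_i]}_{\lambda_i+j-i+s}(x)\right)_{1\le i,j\le r}\in\mathbb{Z}[\beta][[x]],$$ with $\binom{n}{s}=n(n-1)\cdots(n-s+1)/s!$ for $n\in\mathbb{Z}$, $s\ge 0$. For the empty partition both $G_{\lambda,f}$ and $\widetilde G_{\lambda,f}$ are $1$. *)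

(* Defs.v *)
From HB Require Import structures.
From mathcomp Require Import all_boot all_order all_algebra finmap.
From mathcomp Require Import boolp classical_sets cardinality fsbigop.
From mathcomp Require Import monalg zify.

Set Implicit Arguments.
Unset Strict Implicit.
Unset Printing Implicit Defensive.

Import Order.TTheory GRing.Theory Num.Theory.

Local Open Scope classical_set_scope.
Local Open Scope ring_scope.

Record fps (I : choiceType) (R : comNzRingType) :=
  FPS { fcoef : {cmonom I} -> R }.

Section PowerSeries.
Context {I : choiceType} {R : comNzRingType}.
Implicit Types (F G H : fps I R) (m : {cmonom I}).

Lemma fpsP F G : fcoef F =1 fcoef G -> F = G.
Proof. by case: F G => [f] [g] /= /funext ->. Qed.

HB.instance Definition _ := gen_eqMixin (fps I R).
HB.instance Definition _ := gen_choiceMixin (fps I R).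

Definition fps_zero : fps I R := FPS (fun=> 0).
Definition fps_opp F : fps I R := FPS (fun m => - fcoef F m).
Definition fps_add F G : fps I R := FPS (fun m => fcoef F m + fcoef G m).

Fact fps_addA : associative fps_add.
Proof. by move=> F G H; apply: fpsP => m /=; rewrite addrA. Qed.
Fact fps_addC : commutative fps_add.
Proof. by move=> F G; apply: fpsP => m /=; rewrite addrC. Qed.
Fact fps_add0 : left_id fps_zero fps_add.
Proof. by move=> F; apply: fpsP => m /=; rewrite add0r. Qed.
Fact fps_addN : left_inverse fps_zero fps_opp fps_add.
Proof. by move=> F; apply: fpsP => m /=; rewrite addNr. Qed.

HB.instance Definition _ := GRing.isZmodule.Build (fps I R)
  fps_addA fps_addC fps_add0 fps_addN.

Definition fps_cst (c : R) : fps I R := FPS (fun m => if m == mone then c else 0).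

(* There are finitely many factorizations of a monomial (finite_factor), so
   the sum is an ordinary finite sum. *)
Definition fps_mul F G : fps I R := FPS (fun m =>
  \sum_(d \in [set d : {cmonom I} * {cmonom I} | mmul d.1 d.2 = m])
    fcoef F d.1 * fcoef G d.2).

Lemma finite_factor m :
  finite_set [set d : {cmonom I} * {cmonom I} | mmul d.1 d.2 = m].
Proof.
pose T := {ffun finsupp m -> 'I_(mdeg m).+1}.
pose h (g : T) : {cmonom I} :=
  mkcmonom [fsfun i : finsupp m => (g i : nat) | 0%N].
apply: (@sub_finite_set _ _ ((h @` [set: T]) `*` (h @` [set: T]))); last first.
  by apply: finite_setX; apply: finite_image; exact: finite_finset.
have im d e : mmul d e = m -> (h @` [set: T]) d.
  move=> dem; have le_d i : (d i <= m i)%N by rewrite -dem cmM leq_addr.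
  have lt_d i : (d i < (mdeg m).+1)%N.
    rewrite ltnS; apply: leq_trans (le_d i) _; case: (mdomP m i) => // im.
    by rewrite mdegE (big_fsetD1 i im) leq_addr.
  exists [ffun i : finsupp m => Ordinal (lt_d (val i))] => //.
  apply/eqP/cmP => i; rewrite cmE fsfun_ffun.
  case: insubP => [u uP uE|].
    by apply: etrans (congr1 (@nat_of_ord _) (ffunE _ u)) _; rewrite /= -uE.
  by rewrite -cmE_neq0 negbK => /eqP mi0; have := le_d i; rewrite mi0 leqn0 => /eqP.
move=> [d e] /= dem; split; first exact: im dem.
by apply: (im _ d); rewrite mulmC.
Qed.


Lemma finite_divisor m :
  finite_set [set d : {cmonom I} | exists e, mmul d e = m].
Proof.
apply: sub_finite_set (finite_image fst (finite_factor m)).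
by move=> d [e dem]; exists (d, e).
Qed.

Lemma mcoeffM (p q : {malg R[{cmonom I}]}) m : (p * q)@_m =
  \sum_(d \in [set d : {cmonom I} * {cmonom I} | mmul d.1 d.2 = m])
    p@_d.1 * q@_d.2.
Proof.
rewrite (fsbig_finite _ _ (finite_factor m)) /=.
set A := fset_set _.
pose D1 := (msupp p `|` [fset d.1 | d in A])%fset.
pose D2 := (msupp q `|` [fset d.2 | d in A])%fset.
have [sp sq] : (msupp p `<=` D1)%fset /\ (msupp q `<=` D2)%fset.
  by split; apply: fsubsetUl.
have memA d : (d \in A) = (mmul d.1 d.2 == m).
  rewrite in_fset_set; last exact: finite_factor.
  by apply/idP/eqP => [/set_mem|] //= ?; apply/mem_set.
rewrite (mcoeffMlw _ sp sq).
transitivity (\sum_(d <- [seq (a, b) | a <- D1, b <- D2] | mmul d.1 d.2 == m)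
    p@_d.1 * q@_d.2).
  rewrite [RHS]big_mkcond [RHS]big_allpairs; apply: eq_bigr => a _; apply: eq_bigr => b _ /=.
  by case: eqP.
rewrite -[LHS]big_filter; apply: perm_big; apply: uniq_perm.
- apply/filter_uniq/allpairs_uniq => //; try exact: fset_uniq.
  by move=> [? ?] [? ?] _ _ [-> ->].
- exact: fset_uniq.
move=> d; rewrite mem_filter memA; case: eqP => //= dm.
apply/allpairsP; exists d; rewrite -surjective_pairing; split=> //.
- by rewrite in_fsetU; apply/orP; right; apply: in_imfset; rewrite /= memA dm.
- by rewrite in_fsetU; apply/orP; right; apply: in_imfset; rewrite /= memA dm.
Qed.

(* [trunc m F] is a polynomial with the same coefficients as [F] at all the
   divisors of m; the ring axioms are inherited from polynomials through it. *)
Definition trunc m F : {malg R[{cmonom I}]} :=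
  [malg d in fset_set [set d : {cmonom I} | exists e, mmul d e = m] =>
    fcoef F d].

Lemma mcoeff_trunc m F d e : mmul d e = m -> (trunc m F)@_d = fcoef F d.
Proof.
move=> dem; rewrite /trunc mcoeffE in_fset_set; last exact: finite_divisor.
by rewrite mem_set //; exists e.
Qed.

Lemma fps_mulE m F G (p q : {malg R[{cmonom I}]}) :
    (forall d e, mmul d e = m -> p@_d = fcoef F d) ->
    (forall d e, mmul d e = m -> q@_d = fcoef G d) ->
  fcoef (fps_mul F G) m = (p * q)@_m.
Proof.
move=> pF qG; rewrite mcoeffM /=; apply: eq_fsbigr => -[d e] /set_mem /= dem.
by rewrite (pF _ _ dem) (qG e d) // mulmC.
Qed.

Lemma fps_mul_trunc m F G d e : mmul d e = m ->
  (trunc m F * trunc m G)@_d = fcoef (fps_mul F G) d.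
Proof.
move=> dem; symmetry; apply: fps_mulE => a b abd.
  by apply: (@mcoeff_trunc _ _ _ (mmul b e)); rewrite mulmA abd.
by apply: (@mcoeff_trunc _ _ _ (mmul b e)); rewrite mulmA abd.
Qed.

Fact fps_mulA : associative fps_mul.
Proof.
move=> F G H; apply: fpsP => m.
rewrite (@fps_mulE m F _ (trunc m F) (trunc m G * trunc m H)).
- rewrite (@fps_mulE m _ H (trunc m F * trunc m G) (trunc m H)) ?mulrA //.
  + by move=> d e; apply: fps_mul_trunc.
  + by move=> d e; apply: mcoeff_trunc.
- by move=> d e; apply: mcoeff_trunc.
- by move=> d e; apply: fps_mul_trunc.
Qed.

Let mulE m F G : fcoef (fps_mul F G) m = (trunc m F * trunc m G)@_m.
Proof. by apply: fps_mulE => d e; apply: mcoeff_trunc. Qed.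

Fact fps_mulC : commutative fps_mul.
Proof. by move=> F G; apply: fpsP => m; rewrite !mulE mulrC. Qed.

Fact fps_mul1 : left_id (fps_cst 1) fps_mul.
Proof.
move=> F; apply: fpsP => m.
rewrite (@fps_mulE m _ F 1 (trunc m F)).
- by rewrite mul1r (@mcoeff_trunc _ _ _ mone) ?mulm1.
- by move=> d e _; rewrite mcoeff1 /=; case: eqP.
- by move=> d e; apply: mcoeff_trunc.
Qed.

Fact fps_mulDl : left_distributive fps_mul fps_add.
Proof.
move=> F G H; apply: fpsP => m /=.
rewrite -[X in _ = X + _]/(fcoef (fps_mul F H) m).
rewrite -[X in _ = _ + X]/(fcoef (fps_mul G H) m) !mulE -mcoeffD -mulrDl.
rewrite -[LHS]/(fcoef (fps_mul (fps_add F G) H) m).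
apply: fps_mulE => d e dem; last exact: mcoeff_trunc dem.
by rewrite mcoeffD !(mcoeff_trunc _ dem).
Qed.

Fact fps_oner_neq0 : fps_cst 1 != 0 :> fps I R.
Proof.
apply/eqP => /(congr1 (fun F => fcoef F mone)) /= /eqP.
by rewrite eqxx oner_eq0.
Qed.

HB.instance Definition _ := GRing.Zmodule_isComNzRing.Build (fps I R)
  fps_mulA fps_mulC fps_mul1 fps_mulDl fps_oner_neq0.

Definition fps_X (i : I) : fps I R := FPS (fun m => (m == ucm i)%:R).

Definition fps_of_malg (p : {malg R[{cmonom I}]}) : fps I R :=
  FPS (fun m => p@_m).

(* The sum of a family is taken coefficientwise.  [\sum_(k \in D)] is 0 when
   infinitely many terms are non-zero, so [fps_sum F] is meaningful when F is
   [summable]; see summable_umul, summable_G_row and summable_G_tilde_entry. *)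
Definition summable (K : choiceType) (F : K -> fps I R) :=
  forall m, finite_set [set k | fcoef (F k) m <> 0].

Definition fps_sum (K : choiceType) (F : K -> fps I R) : fps I R :=
  FPS (fun m => \sum_(k \in [set: K]) fcoef (F k) m).

Lemma fps_mul_neq0 F G m : fcoef (F * G) m <> 0 ->
  exists d e, [/\ mmul d e = m, fcoef F d <> 0 & fcoef G e <> 0].
Proof.
apply: contra_notP => nodec.
apply: (@fsbig1 _ _ (+%R : Monoid.law _)) => -[d e] /= dem.
have [->|/eqP Fd] := eqVneq (fcoef F d) 0; first by rewrite mul0r.
have [->|/eqP Ge] := eqVneq (fcoef G e) 0; first by rewrite mulr0.
by case: nodec; exists d, e.
Qed.

Lemma fps_sum_neq0 (K : choiceType) (F : K -> fps I R) m :
  fcoef (fps_sum F) m <> 0 -> exists k, fcoef (F k) m <> 0.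
Proof.
apply: contra_notP => no_k.
apply: (@fsbig1 _ _ (+%R : Monoid.law _)) => k _.
by apply: contrapT => Fk; apply: no_k; exists k.
Qed.

(* Series in u and u^-1, given by the family of their coefficients. *)
Definition useries := int -> fps I R.

Definition uone : useries := fun n => (n == 0)%:R.

Definition umul (a b : useries) : useries :=
  fun n => fps_sum (fun k : int => a k * b (n - k)).

End PowerSeries.

Arguments useries : clear implicits.

Notation Zbx := (fps nat {poly int}).

Definition beta : Zbx := fps_cst 'X.

(* x_k, for k >= 1, is the variable of index k - 1. *)
Definition xvar (k : nat) : Zbx := fps_X k.-1.

Definition is_partition (la : seq nat) : bool :=
  sorted geq la && all (ltn 0) la.

Definition is_flagging (la f : seq nat) : bool :=
  [&& size f == size la, sorted leq f & all (ltn 0) f].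

(* Rows and columns are numbered from 0. *)
Definition box (la : seq nat) : finType :=
  {b : 'I_(size la) * 'I_(head 0%N la) | (b.2 < nth 0%N la b.1)%N}.

Definition box_row la (b : box la) : nat := (val b).1.
Definition box_col la (b : box la) : nat := (val b).2.

(* All the entries of a tableau are at most the last, hence largest, term of
   the flagging. *)
Definition filling (la f : seq nat) : finType :=
  {ffun box la -> {set 'I_(last 0%N f).+1}}.

(* These are used for non-empty sets only. *)
Definition set_max n (A : {set 'I_n}) : nat := \max_(k in A) k.
Definition set_min n (A : {set 'I_n}) : nat := \big[minn/n]_(k in A) k.

Definition is_fsvt la f (T : filling la f) : bool :=
  [&& [forall b : box la, (T b != finset.set0) &&
         [forall k in T b, 0 < k <= nth 0%N f (box_row b)]%N],
      [forall b : box la, [forall c : box la,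
         (box_row c == box_row b) && (box_col c == (box_col b).+1) ==>
         (set_max (T b) <= set_min (T c))%N]]
    & [forall b : box la, [forall c : box la,
         (box_row c == (box_row b).+1) && (box_col c == box_col b) ==>
         (set_max (T b) < set_min (T c))%N]]].

Definition num_entries la f (T : filling la f) : nat := (\sum_b #|T b|)%N.

(* The subtraction is not truncated: every box of a tableau is non-empty. *)
Definition G_flagged (la f : seq nat) : Zbx :=
  \sum_(T : filling la f | is_fsvt T)
    beta ^+ (num_entries T - sumn la) * \prod_b \prod_(k in T b) xvar k.

(* 1 / (1 + beta u^-1) = sum_(k >= 0) (- beta)^k u^-k *)
Definition u_inv_factor : useries nat {poly int} :=
  fun n => if n <= 0 then (- beta) ^+ `|n|%N else 0.

(* (1 + beta x_i) / (1 - x_i u) = sum_(k >= 0) (1 + beta x_i) x_i^k u^k *)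
Definition u_factor (i : nat) : useries nat {poly int} :=
  fun n => if 0 <= n then (1 + beta * xvar i) * xvar i ^+ `|n|%N else 0.

Definition u_prod (p : nat) : useries nat {poly int} :=
  \big[@umul _ _/@uone _ _]_(1 <= i < p.+1) u_factor i.

Definition G_row (p : nat) (m : int) : Zbx := umul u_inv_factor (u_prod p) m.

(* The binomial coefficient n (n - 1) ... (n - s + 1) / s!; the division is
   exact. *)
Definition binz (n : int) (s : nat) : int :=
  ((\prod_(t < s) (n - t%:Z)) %/ s`!%:Z)%Z.

Definition G_tilde_entry (la f : seq nat) (i j s : nat) : Zbx :=
  (binz (i%:Z - j%:Z) s)%:~R * beta ^+ s *
  G_row (nth 0%N f i) ((nth 0%N la i)%:Z + j%:Z - i%:Z + s%:Z).

Definition G_tilde (la f : seq nat) : Zbx :=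
  \det (\matrix_(i < size la, j < size la) fps_sum (G_tilde_entry la f i j)).

Definition u_bounded (a : useries nat {poly int}) :=
  forall n m, fcoef (a n) m <> 0 -> 0 <= n <= (mdeg m)%:Z.

Lemma u_bounded_uone : u_bounded (@uone _ _).
Proof.
by move=> n m; rewrite /uone; case: eqP => [-> _|_ /=]; rewrite ?lexx.
Qed.

Lemma summable_umul (a b : useries nat {poly int}) n :
  u_bounded a -> u_bounded b -> summable (fun k : int => a k * b (n - k)).
Proof.
move=> ha hb m.
apply: (sub_finite_set _ (finite_image Posz (finite_II (mdeg m).+1))).
move=> k /= /fps_mul_neq0 [d [e [dem /ha /andP[]]]].
case: k => // k _; rewrite lez_nat => kd _; exists k => //=.
by rewrite ltnS -dem mdegM (leq_trans kd) ?leq_addr.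
Qed.

Lemma u_bounded_umul (a b : useries nat {poly int}) :
  u_bounded a -> u_bounded b -> u_bounded (umul a b).
Proof.
move=> ha hb n m /fps_sum_neq0 [k /fps_mul_neq0 [d [e [<-]]]].
move=> /ha /andP[k0 kd] /hb /andP[nk0 nke].
rewrite -[n](subrK k) addr_ge0 //= mdegM PoszD [X in _ <= X]addrC.
exact: lerD.
Qed.

Lemma fcoef_xvarX i k m : fcoef (xvar i ^+ k) m <> 0 -> mdeg m = k.
Proof.
elim: k m => [|k IH] m.
  by rewrite expr0 /=; case: eqP => // ->; rewrite mdeg1.
rewrite exprS => /fps_mul_neq0 [d [e [<-]]] /= + /IH; rewrite mdegM => + ->.
by case: eqP => // ->; rewrite mdegU.
Qed.

Lemma u_bounded_factor i : u_bounded (u_factor i).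
Proof.
move=> n m; rewrite /u_factor; case: ifP => // n0.
move=> /fps_mul_neq0 [d [e [<- _]]] /fcoef_xvarX.
by rewrite mdegM; lia.
Qed.

Lemma u_bounded_prod p : u_bounded (u_prod p).
Proof.
rewrite /u_prod; apply: big_ind => [||i _].
- exact: u_bounded_uone.
- exact: u_bounded_umul.
- exact: u_bounded_factor.
Qed.

Lemma summable_G_row p n :
  summable (fun k : int => u_inv_factor k * u_prod p (n - k)).
Proof.
move=> m; pose g (j : nat) : int := - j%:Z.
apply: (sub_finite_set _ (finite_image g (finite_II (mdeg m + `|n|).+1))).
move=> k /= /fps_mul_neq0 [d [e [dem]]]; rewrite /u_inv_factor.
case: ifP => // k0 _ /u_bounded_prod /andP[_ ke].
have em : (mdeg e)%:Z <= (mdeg m)%:Z by rewrite lez_nat -dem mdegM leq_addl.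
exists `|k|%N; last by rewrite /g; lia.
by rewrite /=; lia.
Qed.

Lemma G_row_bounded p n m : fcoef (G_row p n) m <> 0 -> n <= (mdeg m)%:Z.
Proof.
move=> /fps_sum_neq0 [k /fps_mul_neq0 [d [e [<-]]]]; rewrite /u_inv_factor.
case: ifP => // k0 _ /u_bounded_prod /andP[_ ke].
by rewrite mdegM; lia.
Qed.

Lemma summable_G_tilde_entry la f i j : summable (G_tilde_entry la f i j).
Proof.
move=> m; apply: (sub_finite_set _ (finite_II (mdeg m + i).+1)).
move=> s Gs; have [d [e [<- _]]] := fps_mul_neq0 Gs.
move=> /G_row_bounded.
by rewrite mdegM /=; lia.
Qed.

(* Main.v *)
Require Import Defs.
From HB Require Import structures.
From mathcomp Require Import all_boot all_order all_algebra.
From mathcomp Require Import zify ring.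

Set Implicit Arguments.
Unset Strict Implicit.
Unset Printing Implicit Defensive.

Import Order.TTheory GRing.Theory Num.Theory.

Local Open Scope ring_scope.

(** Put [w = u + beta] and [z_k = x_k / (1 + beta x_k)]; then
    [(1 + beta x_k) / (1 - x_k u) = 1 / (1 - z_k w)], and the (i, j) entry of
    the matrix is the coefficient of [u^lambda_i] in
    [u w^(i-j-1) / prod_(k <= f_i) (1 - z_k w)].

    Erasing the largest value [p] from a tableau of shape [lambda] leaves a
    tableau of a shape [mu] with [lambda_(i+1) <= mu_i <= lambda_i], and the
    weights of the erased entries multiply to a product over the rows [i] of a
    coefficient depending on [mu_i].  The determinant satisfies the same
    recursion: by multilinearity the sum over [mu] is a single determinant, and
    its row [i] differs from row [i] of the original matrix by a multiple of
    row [i + 1] of the latter.  At [p = 0] both sides are 1 if [lambda] is empty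
    and 0 otherwise.  *)

(** * Set-valued tableaux *)

Section Grid.
Variables (R : comNzRingType) (b : R) (x : nat -> R) (r c N : nat).
Notation cell := ('I_r * 'I_c)%type.
Notation tableau := {ffun cell -> {set 'I_N}}.
Implicit Types (u v : cell) (T : tableau) (g : nat -> nat) (L M P : {set cell}).

Definition next_right u v := (v.1 == u.1) && (v.2 == u.2.+1 :> nat).
Definition next_below u v := (v.1 == u.1.+1 :> nat) && (v.2 == u.2).

(** Cells of the grid may be empty, and an empty cell satisfies all conditions vacuously; the shape
    is prescribed separately through [occupied]. Fillings of all shapes thus share one type. *)
Definition semistandard g T : bool :=
  [&& [forall u, [forall k in T u, 0 < k <= g u.1]%N],
      [forall u, [forall v, next_right u v ==>
         [forall k in T u, [forall l in T v, k <= l]%N]]]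
    & [forall u, [forall v, next_below u v ==>
         [forall k in T u, [forall l in T v, k < l]%N]]]].

Lemma semistandardP g T : reflect
  [/\ forall u k, k \in T u -> (0 < k <= g u.1)%N,
      forall u v, next_right u v ->
        forall k l, k \in T u -> l \in T v -> (k <= l)%N
    & forall u v, next_below u v ->
        forall k l, k \in T u -> l \in T v -> (k < l)%N]
  (semistandard g T).
Proof.
apply: (iffP and3P) => -[T1 T2 T3]; split.
- by move=> u k kT; have /forall_inP := forallP T1 u; apply.
- move=> u v uv k l kT lT; have /implyP/(_ uv) := forallP (forallP T2 u) v.
  by move=> /forall_inP/(_ k kT)/forall_inP; apply.
- move=> u v uv k l kT lT; have /implyP/(_ uv) := forallP (forallP T3 u) v.
  by move=> /forall_inP/(_ k kT)/forall_inP; apply.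
- by apply/forallP => u; apply/forall_inP => k; apply: T1.
- apply/forallP => u; apply/forallP => v; apply/implyP => uv.
  by apply/forall_inP => k kT; apply/forall_inP => l; apply: T2 kT.
- apply/forallP => u; apply/forallP => v; apply/implyP => uv.
  by apply/forall_inP => k kT; apply/forall_inP => l; apply: T3 kT.
Qed.

Definition occupied T : {set cell} := [set u | T u != set0].

(** An empty cell has weight 1, since [0.-1] is 0. *)
Definition box_weight (A : {set 'I_N}) : R :=
  b ^+ #|A|.-1 * \prod_(k in A) x k.

Definition weight T : R := \prod_u box_weight (T u).

Definition tableau_sum L g : R :=
  \sum_(T | semistandard g T && (occupied T == L)) weight T.

Definition add_value (p : 'I_N) T P : tableau :=
  [ffun u => if u \in P then p |: T u else T u].

Definition remove_value (p : 'I_N) T : tableau := [ffun u => T u :\ p].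

Lemma box_weightU1 (p : 'I_N) (A : {set 'I_N}) : p \notin A ->
  box_weight (p |: A) = (if A == set0 then x p else b * x p) * box_weight A.
Proof.
move=> pA; rewrite /box_weight cardsU1 pA big_setU1 //=.
have [->|A0] := eqVneq A set0.
  by rewrite cards0 !big_set0 expr0 !mul1r mulr1.
by rewrite -[#|A| in LHS]prednK ?card_gt0 // exprS; ring.
Qed.

(* The cell [u] of the diagram [L] may receive the value [p], when the cells
   holding smaller values form the set [M]. *)
Definition may_hold g (p : 'I_N) L M u :=
  [&& u \in L, (p <= g u.1)%N, [forall v, next_right u v ==> (v \notin M)]
    & [forall v, next_below u v ==> (v \notin L)]].

(** All other entries are below [p], so [p] can only clash with a smaller entry to its right or with
    any entry below it. Two values [p] may sit side by side, which is why only the smaller values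
    enter the horizontal condition. *)
Lemma add_value_valid g (p : 'I_N) T P L :
    (0 < p)%N -> (forall i, g i <= p)%N -> (forall u, p \notin T u) ->
  semistandard g (add_value p T P) && (occupied (add_value p T P) == L) =
  semistandard (fun i => minn (g i) p.-1) T &&
  [forall u, if u \in P then may_hold g p L (occupied T) u
             else (u \in L) == (u \in occupied T)].
Proof.
move=> p0 gp pT.
have inE u k : k \in add_value p T P u = (k \in T u) || (u \in P) && (k == p).
  rewrite ffunE; case: (u \in P); rewrite ?orbF //.
  by rewrite !inE orbC.
have shE u : (u \in occupied (add_value p T P)) = (u \in P) || (u \in occupied T).
  rewrite !finset.inE ffunE; case: (u \in P) => //=.
  by apply/set0Pn; exists p; rewrite setU11.
have Tne u k : k \in T u -> u \in occupied T.
  by move=> kT; rewrite finset.inE; apply/set0Pn; exists k.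
apply/andP/andP => -[].
- move=> /semistandardP[T1 T2 T3] /eqP shL.
  have ltp u k : k \in T u -> (k < p)%N.
    move=> kT; have /T1/andP[_ kg] : k \in add_value p T P u by rewrite inE kT.
    rewrite ltn_neqAle (leq_trans kg (gp _)) andbT.
    by apply: contraNneq (pT u) => /val_inj <-.
  split.
    apply/semistandardP; split.
    + move=> u k kT; have /T1 : k \in add_value p T P u by rewrite inE kT.
      by have := ltp _ _ kT; lia.
    + by move=> u v uv k l kT lT; apply: (T2 u v); rewrite ?inE ?kT ?lT.
    + by move=> u v uv k l kT lT; apply: (T3 u v); rewrite ?inE ?kT ?lT.
  apply/forallP => u; case: ifP => uP; last by rewrite -shL shE uP.
  have pu : p \in add_value p T P u by rewrite inE uP eqxx orbT.
  apply/and4P; split.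
  + by rewrite -shL shE uP.
  + by have /andP[] := T1 _ _ pu.
  + apply/forallP => v; apply/implyP => uv; rewrite finset.inE negbK.
    apply/set0Pn => -[l lT]; have := ltp _ _ lT; rewrite ltnNge.
    by rewrite (T2 u v) // inE lT.
  + apply/forallP => v; apply/implyP => uv; rewrite -shL finset.inE negbK.
    apply/set0Pn => -[l lT]; have := T3 _ _ uv _ _ pu lT.
    have /andP[_ lg] := T1 _ _ lT.
    by rewrite ltnNge (leq_trans lg (gp _)).
- move=> /semistandardP[T1 T2 T3] /forallP PT.
  have ltp u k : k \in T u -> (k < p)%N by move/T1; lia.
  have PH u : u \in P -> may_hold g p L (occupied T) u by have := PT u; case: ifP.
  have shL : occupied (add_value p T P) = L.
    apply/setP => u; rewrite shE; have := PT u; case: ifP => [_ /and4P[-> //]|_].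
    by move=> /eqP ->.
  split; last exact/eqP.
  apply/semistandardP; split.
  + move=> u k; rewrite inE => /orP[/T1|/andP[/PH/and4P[_ pg _ _] /eqP ->]].
      by lia.
    by rewrite p0.
  + move=> u v uv k l; rewrite !inE.
    move=> /orP[kT|/andP[uP /eqP ->]] /orP[lT|/andP[vP /eqP ->]] //.
    * exact: T2 uv _ _ kT lT.
    * exact/ltnW/ltp/kT.
    * have /and4P[_ _ /forallP/(_ v)/implyP/(_ uv) + _] := PH _ uP.
      by rewrite (Tne _ _ lT).
  + move=> u v uv k l; rewrite [k \in _]inE.
    move=> /orP[kT|/andP[uP /eqP ->]].
      by rewrite inE => /orP[lT|/andP[_ /eqP ->]];
        [exact: T3 uv _ _ kT lT|exact: ltp kT].
    move=> lT; have /and4P[_ _ _ /forallP/(_ v)/implyP/(_ uv)] := PH _ uP.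
    by rewrite -shL finset.inE; case/set0Pn; exists l.
Qed.

(** The two choices at a cell: it receives [p], with an extra factor [b] if it already holds smaller
    values, or it does not, and then it belongs to both shapes or to neither. *)
Definition cell_coef g (p : 'I_N) L M u : R :=
  (if may_hold g p L M u then (if u \in M then b * x p else x p) else 0) +
  ((u \in L) == (u \in M))%:R.

(** The condition on [P] concerns each cell separately, so the sum over [P] is the expansion of a
    product over cells of two-term sums. *)
Lemma sum_add_value g (p : 'I_N) T L :
    (0 < p)%N -> (forall i, g i <= p)%N -> (forall u, p \notin T u) ->
  \sum_(P | semistandard g (add_value p T P) && (occupied (add_value p T P) == L))
     weight (add_value p T P) =
  if semistandard (fun i => minn (g i) p.-1) T then
    (\prod_u cell_coef g p L (occupied T) u) * weight T else 0.
Proof.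
move=> p0 gp pT.
rewrite (eq_bigl _ _ (fun P => add_value_valid P L p0 gp pT)).
case: ifP => _; last by rewrite big_pred0.
rewrite /= /weight -big_split /=.
pose F u := (if may_hold g p L (occupied T) u then
  (if u \in occupied T then b * x p else x p) else 0) * box_weight (T u).
pose G u := ((u \in L) == (u \in occupied T))%:R * box_weight (T u).
transitivity (\prod_u (F u + G u)); last first.
  by apply: eq_bigr => u _; rewrite -mulrDl.
rewrite bigA_distr big_mkcond; apply: eq_bigr => P _ /=.
case: ifP => [/forallP PT|/negbT].
  apply: eq_bigr => u _; rewrite ffunE; have := PT u; rewrite /F /G.
  case: ifP => _ => [->|->]; last by rewrite mul1r.
  by rewrite box_weightU1 // finset.inE if_neg.
rewrite negb_forall => /existsP[u Pu]; rewrite (bigD1 u) //=.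
rewrite /F /G; case: ifP Pu => _ /negbTE ->; by rewrite !mul0r.
Qed.

(** Tableaux are grouped by what remains after erasing [p], then by the shape of the remainder. The
    fibre over [T] is parametrized by the set [P] of cells that contained [p]. *)
Lemma tableau_sum_step g (p : 'I_N) L : (0 < p)%N -> (forall i, g i <= p)%N ->
  tableau_sum L g = \sum_M (\prod_u cell_coef g p L M u) *
    tableau_sum M (fun i => minn (g i) p.-1).
Proof.
move=> p0 gp; rewrite /tableau_sum.
rewrite (partition_big (remove_value p) (fun T => [forall u, p \notin T u])) /=.
  transitivity (\sum_(T | semistandard (fun i => minn (g i) p.-1) T)
      (\prod_u cell_coef g p L (occupied T) u) * weight T); last first.
    rewrite (partition_big occupied xpredT) //=; apply: eq_bigr => M _.
    by rewrite mulr_sumr; apply: eq_bigr => T /andP[_ /eqP ->].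
  rewrite [LHS]big_mkcond [RHS]big_mkcond; apply: eq_bigr => T _ /=.
  case: ifP => [/forallP pT|/negbT].
    rewrite -sum_add_value // (reindex_onto (add_value p T)
      (fun T' => [set u | p \in T' u])) /=; last first.
      move=> T' /andP[_ /eqP T'T]; apply/ffunP => u; rewrite ffunE inE -T'T ffunE.
      by case: ifP => pT';
        [rewrite setD1K|apply/setDidPl; rewrite disjoint_sym disjoints1 pT'].
    apply: eq_bigl => P.
    have -> : remove_value p (add_value p T P) = T.
      apply/ffunP => u; rewrite !ffunE; case: ifP => _; first exact: setU1K.
      by apply/setDidPl; rewrite disjoint_sym disjoints1.
    have -> : [set u | p \in add_value p T P u] = P.
      apply/setP => u; rewrite inE ffunE; case: ifP => _; first exact: setU11.
      exact: negbTE.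
    by rewrite !eqxx !andbT.
  (* A filling that still contains [p] is no remainder, and on the right it breaks the bound
     [p.-1]. *)
  rewrite negb_forall => /existsP[u]; rewrite negbK => pTu.
  case: ifP => // /semistandardP[/(_ u p pTu)].
  by lia.
by move=> T _; apply/forallP => u; rewrite ffunE !inE eqxx.
Qed.

(** * Diagrams and the change of row lengths under erasure *)

Definition diagram (la : 'I_r -> nat) : {set cell} := [set u : cell | (u.2 < la u.1)%N].

Definition row_lengths M : {ffun 'I_r -> 'I_c.+1} :=
  [ffun i => inord (\max_(j | (i, j) \in M) j.+1)].

Lemma row_lengthE M i : row_lengths M i = (\max_(j | (i, j) \in M) j.+1)%N :> nat.
Proof.
rewrite ffunE inordK // ltnS; apply/bigmax_leqP => j _; exact: ltn_ord.
Qed.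

Lemma diagramK (mu : {ffun 'I_r -> 'I_c.+1}) :
  row_lengths (diagram (fun i => mu i)) = mu.
Proof.
apply/ffunP => i; apply: ord_inj; rewrite row_lengthE.
apply/eqP; rewrite eqn_leq; apply/andP; split.
  by apply/bigmax_leqP => j; rewrite inE.
case mE: (nat_of_ord (mu i)) => [//|k].
have kc : (k < c)%N by have := ltn_ord (mu i); rewrite ltnS mE.
by apply: (leq_bigmax_cond (Ordinal kc)); rewrite inE /= mE.
Qed.

Lemma diagram_row_lengths M :
    (forall u v, next_right u v -> v \in M -> u \in M) ->
  diagram (fun i => row_lengths M i) = M.
Proof.
move=> Mleft; apply/setP => -[i j]; rewrite inE /= row_lengthE.
apply/idP/idP => [jM|ijM]; last exact: (leq_bigmax_cond j).
have [k kM jk] : exists2 k, (i, k) \in M & (j <= k)%N.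
  apply/exists_inP; apply: contraTT jM; rewrite negb_exists_in -leqNgt.
  move=> /forall_inP jM; apply/bigmax_leqP => k /jM; by rewrite -ltnNge.
have down d (k1 j1 : 'I_c) : k1 = (j1 + d)%N :> nat ->
    (i, k1) \in M -> (i, j1) \in M.
  elim: d j1 => [|d IH] j1; first by rewrite addn0 => /val_inj ->.
  move=> k1E k1M; have j1c : (j1.+1 < c)%N by have := ltn_ord k1; lia.
  apply: (Mleft (i, j1) (i, Ordinal j1c)); first by rewrite /next_right /= !eqxx.
  by apply: IH k1M; rewrite k1E /=; lia.
by apply: (down (k - j)%N k j); rewrite // subnKC.
Qed.

(** The total weight of the values erased from a row of length [l], above a row of length [l'], when
    [m] cells survive. The [l - m] lost cells held only the erased value; the last surviving cell
    may have held it too, at a factor [b * y], provided no cell lies below it, that is [l' < m]. *)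
Definition strip_coef (y : R) (l l' m : nat) : R :=
  if (l' <= m <= l)%N then y ^+ (l - m) * (1 + b * y *+ (l' < m)%N) else 0.

Definition row_coef (t : bool) (y : R) (l l' m : nat) : R :=
  if t then strip_coef y l l' m else (m == l)%:R.

(** If [t] holds and [l' <= m <= l], the factor is 1 in the columns before [m.-1] and from [l] on,
    [y] from [m] to [l.-1], and carries the optional term in column [m.-1]. For an inadmissible [m]
    the factor of column [l] or of column [m] vanishes. *)
Lemma row_coefE (t : bool) y (l l' m : nat) :
    (l' <= l <= c)%N -> (m <= c)%N ->
  \prod_(j < c) ((if [&& (j < l)%N, t, (m <= j.+1)%N & (l' <= j)%N]
                  then (if (j < m)%N then b * y else y) else 0) +
                 ((j < l)%N == (j < m)%N)%:R) =
  row_coef t y l l' m.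
Proof.
move=> /andP[l'l lc] mc.
pose H j : R := ((if [&& (j < l)%N, t, (m <= j.+1)%N & (l' <= j)%N]
  then (if (j < m)%N then b * y else y) else 0) + ((j < l)%N == (j < m)%N)%:R).
rewrite -[LHS]/(\prod_(j < c) H j).
have prod0 k : (k < c)%N -> H k = 0 -> \prod_(j < c) H j = 0.
  by move=> kc Hk; rewrite (bigD1 (Ordinal kc)) //= Hk mul0r.
have prod_small : (l < m)%N -> \prod_(j < c) H j = 0.
  move=> lm; apply: (prod0 l); first exact: leq_trans mc.
  by rewrite /H ltnn /= lm add0r.
rewrite /row_coef /strip_coef; case: ifP => tE; last first.
  have [ml|ml] := eqVneq m l.
    by rewrite big1 // => j _; rewrite /H tE andbF ml eqxx add0r.
  have [lm|ml'] := ltnP l m; first exact: prod_small.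
  have {}ml : (m < l)%N by rewrite ltn_neqAle ml.
  apply: (prod0 m); first exact: leq_trans lc.
  by rewrite /H tE andbF ltnn ml add0r.
case: ifP => [/andP[l'm ml]|]; last first.
  move/negbT; rewrite negb_and -!ltnNge => /orP[ml'|]; last exact: prod_small.
  apply: (prod0 m); first by lia.
  by rewrite /H [(l' <= m)%N]leqNgt ml' !andbF ltnn (leq_trans ml') // add0r.
rewrite -(big_mkord xpredT H) (big_cat_nat (n := m)) //=.
rewrite (big_cat_nat (m := m) (n := l)) //= mulrA mulrC.
rewrite big_nat_cond big1 ?mul1r => [|j /andP[/andP[lj _] _]]; last first.
  by rewrite /H ltnNge lj /= ltnNge (leq_trans ml) // add0r.
rewrite mulrC; congr (_ * _).
  rewrite -prodr_const_nat; apply: eq_big_nat => j /andP[mj jl].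
  by rewrite /H jl tE (leqW mj) (leq_trans l'm mj) /= ltnNge mj addr0.
have Hlt j : (j < m)%N -> H j = 1 + b * y *+ ((j.+1 == m) && (l' <= j)%N).
  move=> jm; rewrite /H jm (leq_trans jm ml) tE /= addrC; congr (_ + _).
  by rewrite eqn_leq jm /=; case: ifP.
rewrite big_nat; under eq_bigr => j jm do rewrite Hlt //; rewrite -big_nat /=.
case: (m) => [|k]; first by rewrite big_geq // addr0.
rewrite big_nat_recr //= eqxx ltnS big_nat_cond big1 ?mul1r // => j.
by rewrite andbT eqSS => /= /ltn_eqF ->; rewrite addr0.
Qed.

Lemma prod_cell_coef g (p : 'I_N) (la : nat -> nat) (mu : {ffun 'I_r -> 'I_c.+1}) :
    (forall i, la i.+1 <= la i <= c)%N -> la r = 0%N ->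
  \prod_u cell_coef g p (diagram (fun i => la i)) (diagram (fun i => mu i)) u =
  \prod_(i < r) row_coef (p <= g i)%N (x p) (la i) (la i.+1) (mu i).
Proof.
move=> la_dec la_r.
transitivity (\prod_(i < r) \prod_(j < c)
    cell_coef g p (diagram (fun i => la i)) (diagram (fun i => mu i)) (i, j)).
  by rewrite pair_bigA /=; apply: eq_bigr => -[].
apply: eq_bigr => i _; rewrite -(row_coefE _ _ (la_dec i)); last first.
  by rewrite -ltnS ltn_ord.
apply: eq_bigr => j _; rewrite /cell_coef.
suff -> : may_hold g p (diagram (fun i => la i)) (diagram (fun i => mu i)) (i, j) =
    [&& j < la i, p <= g i, mu i <= j.+1 & la i.+1 <= j]%N by rewrite !inE.
rewrite /may_hold inE /=; congr (_ && (_ && (_ && _))).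
  apply/forallP/idP => [mr|mj v].
    rewrite leqNgt; apply/negP => jm.
    have jc : (j.+1 < c)%N by apply: leq_trans jm _; rewrite -ltnS ltn_ord.
    have := mr (i, Ordinal jc); rewrite /next_right /= !eqxx /= inE /=.
    by rewrite jm.
  apply/implyP => /andP[/eqP v1 /eqP v2]; rewrite inE /= v1 v2 -leqNgt; exact: mj.
apply/forallP/idP => [mr|mj v].
  rewrite leqNgt; apply/negP => jl.
  (* The last row has nothing below it; there [la r = 0] makes the inequality automatic. *)
  have [ir|ir] := ltnP i.+1 r; last first.
    have ri : i.+1 = r by apply/eqP; rewrite eqn_leq ir ltn_ord.
    by rewrite ri la_r in jl.
  have := mr (Ordinal ir, j); rewrite /next_below /= !eqxx /= inE /=.
  by rewrite jl.
by apply/implyP => /andP[/eqP v1 /eqP v2]; rewrite inE /= v1 v2 -leqNgt.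
Qed.

(** If [v] were in [M] and [u] not, [u] could not hold [p] because of the smaller value to its
    right, so its factor would vanish. Hence only left-justified [M] contribute to the recursion. *)
Lemma cell_coef_neq0_left g (p : 'I_N) (la : nat -> nat) M :
    (forall i, la i.+1 <= la i <= c)%N ->
    \prod_u cell_coef g p (diagram (fun i => la i)) M u != 0 ->
  forall u v, next_right u v -> v \in M -> u \in M.
Proof.
move=> la_dec cM u v uv vM.
have c0 w : cell_coef g p (diagram (fun i => la i)) M w != 0.
  by apply: contraNneq cM => w0; rewrite (bigD1 w) //= w0 mul0r.
have vL : v \in diagram (fun i => la i).
  apply: contraNT (c0 v) => /negbTE vL.
  by rewrite /cell_coef /may_hold vL vM addr0.
have uL : u \in diagram (fun i => la i).
  move: vL uv; rewrite !inE /next_right => vL /andP[/eqP <- /eqP v2].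
  by apply: leq_ltn_trans vL; rewrite v2.
apply: contraNT (c0 u) => /negbTE uM; rewrite /cell_coef /may_hold uL uM.
rewrite (_ : [forall w, _] = false) ?andbF ?addr0 //.
by apply/negbTE/forallPn; exists v; rewrite uv vM.
Qed.

Lemma tableau_sum_diagram g (p : 'I_N) (la : nat -> nat) :
    (0 < p)%N -> (forall i, g i <= p)%N ->
    (forall i, la i.+1 <= la i <= c)%N -> la r = 0%N ->
  tableau_sum (diagram (fun i => la i)) g =
  \sum_(mu : {ffun 'I_r -> 'I_c.+1})
    (\prod_(i < r) row_coef (p <= g i)%N (x p) (la i) (la i.+1) (mu i)) *
    tableau_sum (diagram (fun i => mu i)) (fun i => minn (g i) p.-1).
Proof.
move=> p0 gp la_dec la_r; rewrite (tableau_sum_step _ p0 gp).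
rewrite (bigID (fun M => diagram (fun i => row_lengths M i) == M)) /=.
rewrite [X in _ + X]big1 ?addr0 => [|M Mdiag]; last first.
  suff -> : \prod_u cell_coef g p (diagram (fun i => la i)) M u = 0 by rewrite mul0r.
  apply: contraNeq Mdiag => cM; apply/eqP/diagram_row_lengths.
  exact: cell_coef_neq0_left cM.
rewrite (reindex_onto (fun mu : {ffun 'I_r -> 'I_c.+1} => diagram (fun i => mu i))
  row_lengths) /=; last by move=> M /eqP.
rewrite (eq_bigl xpredT) => [|mu]; last by rewrite diagramK !eqxx.
by apply: eq_bigr => mu _; rewrite prod_cell_coef.
Qed.

End Grid.

From mathcomp Require Import finmap boolp classical_sets cardinality fsbigop.
From mathcomp Require Import monalg.

Local Open Scope classical_set_scope.

(** * Sums of families of power series *)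

Section Sums.
Context {I : choiceType} {R : comNzRingType}.
Implicit Types (F G : fps I R).

Lemma fcoefD F G m : fcoef (F + G) m = fcoef F m + fcoef G m.
Proof. by []. Qed.

Lemma fps_sumE (K : choiceType) (F : K -> fps I R) m (A : {fset K}) :
    (forall k, fcoef (F k) m <> 0 -> k \in A) ->
  fcoef (fps_sum F) m = \sum_(k <- A) fcoef (F k) m.
Proof.
move=> FA; rewrite /= (fsbigTE A) // => k kA.
by have [//|/eqP /FA] := eqVneq (fcoef (F k) m) 0; rewrite (negbTE kA).
Qed.

Lemma summableP (K : choiceType) (F : K -> fps I R) m : summable F ->
  exists A : {fset K}, forall k, fcoef (F k) m <> 0 -> k \in A.
Proof.
move=> sF; exists (fset_set [set k | fcoef (F k) m <> 0]) => k Fk.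
by rewrite in_fset_set //; apply/mem_set.
Qed.

Lemma fps_sumD (K : choiceType) (F G : K -> fps I R) :
  summable F -> summable G ->
  fps_sum (fun k => F k + G k) = fps_sum F + fps_sum G.
Proof.
move=> sF sG; apply: fpsP => m.
have [A FA] := summableP m sF; have [B GB] := summableP m sG.
have FAB k : fcoef (F k) m <> 0 -> k \in (A `|` B)%fset.
  by move/FA => kA; rewrite in_fsetU kA.
have GAB k : fcoef (G k) m <> 0 -> k \in (A `|` B)%fset.
  by move/GB => kB; rewrite in_fsetU kB orbT.
rewrite fcoefD (fps_sumE FAB) (fps_sumE GAB) -big_split.
rewrite (@fps_sumE _ _ m (A `|` B)%fset) // => k.
rewrite fcoefD; have [/eqP Fk|/eqP Fk _] := boolP (fcoef (F k) m == 0).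
  by rewrite Fk add0r => /GAB.
exact: FAB.
Qed.

(** Only finitely many pairs multiply to [m], and the second member of each has a nonzero
    coefficient in finitely many [F k]; one finite index set [A] then serves both sides. *)
Lemma fps_sumMl (K : choiceType) (H : fps I R) (F : K -> fps I R) :
  summable F -> fps_sum (fun k => H * F k) = H * fps_sum F.
Proof.
move=> sF; apply: fpsP => m.
pose Dm := fset_set [set d : {cmonom I} * {cmonom I} | mmul d.1 d.2 = m].
have mulE U V : fcoef (U * V) m = \sum_(d <- Dm) fcoef U d.1 * fcoef V d.2.
  by rewrite [LHS]/= (fsbig_finite _ _ (finite_factor m)).
have sFE d : exists A : {fset K}, forall k, fcoef (F k) d <> 0 -> k \in A.
  exact: summableP.
have {sFE} [h hP] := choice sFE.
pose A := (\bigcup_(d <- Dm) h d.2)%fset.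
have FA d k : d \in Dm -> fcoef (F k) d.2 <> 0 -> k \in A.
  by move=> dD /hP kh; apply/bigfcupP; exists d; rewrite ?dD.
rewrite (@fps_sumE _ _ m A); last first.
  move=> k; apply: contra_notT => kA; rewrite mulE big1_seq // => d /= dD.
  have [->|/eqP Fk] := eqVneq (fcoef (F k) d.2) 0; first by rewrite mulr0.
  by rewrite (FA d) in kA.
under eq_bigr => k _ do rewrite mulE.
rewrite exchange_big mulE [LHS]big_seq_cond [RHS]big_seq_cond.
apply: eq_bigr => d; rewrite andbT => dD.
by rewrite -mulr_sumr (@fps_sumE _ _ _ A) // => k; apply: FA.
Qed.

Lemma summableMl (K : choiceType) (H : fps I R) (F : K -> fps I R) :
  summable F -> summable (fun k => H * F k).
Proof.
move=> sF m.
pose Dm := fset_set [set d : {cmonom I} * {cmonom I} | mmul d.1 d.2 = m].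
have sFE d : exists A : {fset K}, forall k, fcoef (F k) d <> 0 -> k \in A.
  exact: summableP.
have {sFE} [h hP] := choice sFE.
apply: (@sub_finite_set _ _ [set` (\bigcup_(d <- Dm) h d.2)%fset]); last first.
  exact: finite_fset.
move=> k /= /fps_mul_neq0 [d [e [dem _ /hP ke]]].
apply/bigfcupP; exists (d, e) => //.
by rewrite andbT in_fset_set; [apply/mem_set|apply: finite_factor].
Qed.

Lemma fps_sum1 (K : choiceType) (F : K -> fps I R) k0 :
  (forall k, k <> k0 -> F k = 0) -> fps_sum F = F k0.
Proof.
move=> F0; apply: fpsP => m; rewrite (@fps_sumE _ _ m [fset k0]%fset) ?big_seq_fset1 //.
by move=> k; rewrite inE; case: eqP => // /F0 ->.
Qed.

Lemma fps_sum_reindex (K L : choiceType) (h : K -> L) (F : L -> fps I R) :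
  bijective h -> fps_sum (F \o h) = fps_sum F.
Proof.
move=> [h' hK h'K]; apply: fpsP => m /=; symmetry.
apply: (@reindex_fsbigT _ _ +%R _ _ h (fun k => fcoef (F k) m)).
by exists h'.
Qed.

Lemma fps_sum_nat_recl (F : nat -> fps I R) :
  summable F -> fps_sum F = F 0%N + fps_sum (fun k => F k.+1).
Proof.
move=> sF; apply: fpsP => m; have [A FA] := summableP m sF.
pose n := (\max_(k <- A) k).+1.
have le_n k : fcoef (F k) m <> 0 -> (k < n)%N.
  by move/FA => kA; rewrite ltnS; apply: leq_bigmax_seq.
have sumE (G : nat -> fps I R) N : (forall k, fcoef (G k) m <> 0 -> (k < N)%N) ->
    fcoef (fps_sum G) m = \sum_(0 <= k < N) fcoef (G k) m.
  move=> GN; rewrite (@fps_sumE _ _ _ [fset k | k in iota 0 N]%fset).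
    rewrite big_imfset //= undup_id ?iota_uniq // /index_iota subn0.
    exact: eq_bigr.
  by move=> k /GN kN; apply/imfsetP; exists k => //=; rewrite mem_iota.
rewrite fcoefD (sumE _ n.+1) => [|k /le_n /ltnW//].
rewrite (sumE _ n) => [|k /le_n]; last exact: ltnW.
by rewrite big_nat_recl.
Qed.

End Sums.
(** * Binomial coefficients with an integer upper argument *)

(** The falling factorial of length [s.+1] grows by [s.+1] times the one of length [s] when its
    argument grows by 1. As it vanishes at 0, divisibility spreads from there in both directions. *)
Lemma fact_dvd_falling (s : nat) (n : int) :
  (s`!%:Z %| \prod_(t < s) (n - t%:Z))%Z.
Proof.
elim: s n => [|s IH] n; first by rewrite big_ord0 dvd1z.
have step m : \prod_(t < s.+1) (m + 1 - t%:Z) =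
    \prod_(t < s.+1) (m - t%:Z) + s.+1%:Z * \prod_(t < s) (m - t%:Z).
  rewrite big_ord_recl big_ord_recr /= subr0.
  rewrite (eq_bigr (fun t : 'I_s => m - t%:Z)); last first.
    by move=> t _; rewrite /bump /=; lia.
  by rewrite -addn1 PoszD; ring.
have fdvd m : (s.+1`!%:Z %| s.+1%:Z * \prod_(t < s) (m - t%:Z))%Z.
  by rewrite factS PoszM dvdz_mul2l //; apply/orP; right.
elim/int_ind: n => [|n|n].
- by rewrite big_ord_recl /= subr0 mul0r dvdz0.
- move=> IHn; rewrite -[n.+1]addn1 PoszD step; exact: rpredD.
- have nE : - n%:Z = - n.+1%:Z + 1 by rewrite -addn1 PoszD; ring.
  by rewrite nE step rpredDr.
Qed.

Lemma binz0 n : binz n 0 = 1.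
Proof. by rewrite /binz big_ord0. Qed.

Lemma binz0n s : binz 0 s = (s == 0%N)%:Z.
Proof.
case: s => [|s]; first exact: binz0.
by rewrite /binz big_ord_recl /= subr0 mul0r div0z.
Qed.

Lemma binzS n s : binz (n + 1) s.+1 = binz n s.+1 + binz n s.
Proof.
have f0 k : (k`!%:Z != 0) by rewrite eqz_nat -lt0n fact_gt0.
apply: (mulIf (f0 s.+1)); rewrite mulrDl /binz.
rewrite !divzK ?fact_dvd_falling // factS PoszM mulrCA divzK ?fact_dvd_falling //.
rewrite big_ord_recl big_ord_recr /= subr0.
rewrite (eq_bigr (fun t : 'I_s => n - t%:Z)); last first.
  by move=> t _; rewrite /bump /=; lia.
by rewrite -addn1 PoszD; ring.
Qed.

(** * Entries of the matrix *)

Lemma umul_uone (a : useries nat {poly int}) n : umul a (@uone _ _) n = a n.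
Proof.
rewrite /umul (fps_sum1 (k0 := n)) /uone ?subrr ?mulr1 // => k kn.
by rewrite subr_eq0; case: eqP => [e|_]; rewrite ?mulr0 //; case: kn.
Qed.

(** In terms of series: [(1 - x u) b = y c] implies [(1 - x u) a b = y a c]. *)
Lemma umul_recr (a b c : useries nat {poly int}) (x y : Zbx) n :
    (forall n, summable (fun k : int => a k * b (n - k))) ->
    (forall n, summable (fun k : int => a k * c (n - k))) ->
    (forall n, b n - x * b (n - 1) = y * c n) ->
  umul a b n - x * umul a b (n - 1) = y * umul a c n.
Proof.
move=> sb sc bc; rewrite /umul -mulNr -!fps_sumMl // -fps_sumD //; last first.
  exact: summableMl.
congr fps_sum; apply/funext => k.
by rewrite [RHS]mulrCA -bc -[n - 1 - k]addrAC; ring.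
Qed.

Lemma u_factor_recr i n :
  u_factor i n - xvar i * u_factor i (n - 1) = (1 + beta * xvar i) * uone n.
Proof.
rewrite /u_factor /uone; case: n => [[|n]|n].
- by rewrite /= mulr0 subr0 expr0.
- have -> : n.+1%:Z - 1 = n by lia.
  by rewrite /= mulrCA -exprS subrr mulr0.
- have -> : Negz n - 1 = Negz n.+1 by lia.
  by rewrite /= !mulr0 subr0.
Qed.

(** The product nests to the right, so the factor of the last index is innermost; [u_prod_seq_rcons]
    carries its recurrence outwards through the others. *)
Definition u_prod_seq (s : seq nat) : useries nat {poly int} :=
  \big[@umul _ _/@uone _ _]_(i <- s) u_factor i.

Lemma u_bounded_prod_seq s : u_bounded (u_prod_seq s).
Proof.
rewrite /u_prod_seq; apply: big_ind => [||i _].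
- exact: u_bounded_uone.
- exact: u_bounded_umul.
- exact: u_bounded_factor.
Qed.

Lemma u_prod_seq_rcons s i n :
  u_prod_seq (rcons s i) n - xvar i * u_prod_seq (rcons s i) (n - 1) =
  (1 + beta * xvar i) * u_prod_seq s n.
Proof.
elim: s n => [|k s IH] n; rewrite /u_prod_seq /=.
  by rewrite big_cons big_nil !umul_uone u_factor_recr.
rewrite !big_cons; apply: umul_recr IH => m; apply: summable_umul.
all: by [exact: u_bounded_factor|exact: u_bounded_prod_seq].
Qed.

Lemma G_row_recr p n :
  G_row p.+1 n - xvar p.+1 * G_row p.+1 (n - 1) =
  (1 + beta * xvar p.+1) * G_row p n.
Proof.
rewrite /G_row; apply: (@umul_recr _ (u_prod p.+1) (u_prod p)).
- exact: (summable_G_row p.+1).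
- exact: (summable_G_row p).
move=> m; have -> : u_prod p.+1 = u_prod_seq (rcons (index_iota 1 p.+1) p.+1).
  rewrite /u_prod_seq /u_prod /index_iota !subSS !subn0 -[in LHS](addn1 p).
  by rewrite iotaD add1n cats1.
exact: (u_prod_seq_rcons (index_iota 1 p.+1)).
Qed.

Lemma G_row_flag0 n : G_row 0 n = u_inv_factor n.
Proof.
have -> : u_inv_factor n = umul u_inv_factor (@uone _ _) n by rewrite umul_uone.
by rewrite /G_row /u_prod big_nil.
Qed.

(** Multiplying the generating series by [1 + beta u^-1] leaves [u_prod p], which has no negative
    powers of [u]. *)
Lemma G_row_neg p n : n < 0 -> G_row p n = - beta * G_row p (n + 1).
Proof.
move=> n0; rewrite /G_row /umul -fps_sumMl; last exact: summable_G_row.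
have shift_bij : bijective (fun k : int => k + 1).
  by exists (fun k : int => k - 1) => k; rewrite ?addrK ?subrK.
rewrite -[RHS](fps_sum_reindex _ shift_bij).
congr fps_sum; apply/funext => k /=.
rewrite opprD addrACA subrr addr0 mulrA.
have [k0|k0] := ltP k 0.
  congr (_ * _); rewrite /u_inv_factor (ltW k0).
  have -> : k + 1 <= 0 by lia.
  by rewrite -exprS; congr (_ ^+ _); lia.
suff -> : u_prod p (n - k) = 0 by rewrite !mulr0.
apply: fpsP => m.
have [->//|/eqP Pm] := eqVneq (fcoef (u_prod p (n - k)) m) 0.
by have /andP[nk _] := u_bounded_prod Pm; lia.
Qed.

Lemma summable_geometric i : summable (fun k => (- beta * xvar i) ^+ k).
Proof.
move=> m; apply: (sub_finite_set _ (finite_II (mdeg m).+1)) => k /=.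
rewrite exprMn => /fps_mul_neq0 [d [e [<- _ /fcoef_xvarX <-]]].
by rewrite ltnS mdegM leq_addl.
Qed.

Lemma one_plus_beta_xvar_inv i : exists w, w * (1 + beta * xvar i) = 1.
Proof.
exists (fps_sum (fun k => (- beta * xvar i) ^+ k)).
have sg := summable_geometric i.
rewrite mulrC mulrDl mul1r [X in X + _]fps_sum_nat_recl // expr0 -addrA.
rewrite (_ : fps_sum _ = - beta * xvar i * fps_sum (fun k => (- beta * xvar i) ^+ k)).
  by rewrite -mulrDl mulNr addNr mul0r addr0.
by rewrite -fps_sumMl //; congr fps_sum; apply/funext => k; rewrite exprS.
Qed.

(** [G_row_recr] at 0, with [G_row_neg] for the index -1, shows that the values for [p.+1] and [p]
    agree after multiplication by [1 + beta x], which is invertible. *)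
Lemma G_row_eq1 p : G_row p 0 = 1.
Proof.
elim: p => [|p IH]; first by rewrite G_row_flag0 /u_inv_factor /= expr0.
have := G_row_recr p 0; rewrite IH mulr1 (G_row_neg _ (n := 0 - 1)) //.
rewrite subrK => G0; have [w wE] := one_plus_beta_xvar_inv p.+1.
suff : w * (1 + beta * xvar p.+1) * G_row p.+1 0 = w * (1 + beta * xvar p.+1).
  by rewrite wE mul1r.
by rewrite -mulrA -[in RHS]G0; ring.
Qed.

(** The row number, the part [m] and the flag [p] are independent parameters, since the recursions
    below change them separately. *)
Definition jt_term (i j : nat) (m : int) (p s : nat) : Zbx :=
  (binz (i%:Z - j%:Z) s)%:~R * beta ^+ s * G_row p (m + j%:Z - i%:Z + s%:Z).

(* Locked: unfolding entries with distinct flags during unification does not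
   terminate in practice. *)
HB.lock Definition jt_entry (i j : nat) (m : int) (p : nat) : Zbx :=
  fps_sum (jt_term i j m p).

Lemma summable_jt i j m p : summable (jt_term i j m p).
Proof.
move=> d; apply: (sub_finite_set _ (finite_II (mdeg d + i + `|m|).+1)).
move=> s Gs; have [d1 [d2 [<- _]]] := fps_mul_neq0 Gs.
by move=> /G_row_bounded; rewrite mdegM /=; lia.
Qed.

Lemma jt_entry_recr i j m p :
  jt_entry i j m p.+1 - xvar p.+1 * jt_entry i j (m - 1) p.+1 =
  (1 + beta * xvar p.+1) * jt_entry i j m p.
Proof.
have sjt := summable_jt; rewrite jt_entry.unlock -mulNr -!fps_sumMl // -fps_sumD //.
  congr fps_sum; apply/funext => s; rewrite /jt_term [RHS]mulrCA -G_row_recr.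
  have -> : m - 1 + j%:Z - i%:Z + s%:Z = m + j%:Z - i%:Z + s%:Z - 1 by ring.
  by ring.
exact: summableMl.
Qed.

(** Pascal's rule in the upper argument [i - j]; on generating series, multiplication by
    [u + beta]. *)
Lemma jt_entry_pascal i j m p :
  jt_entry i.+1 j m p = jt_entry i j (m - 1) p + beta * jt_entry i j m p.
Proof.
have sjt := summable_jt; rewrite jt_entry.unlock -fps_sumMl //.
rewrite [LHS]fps_sum_nat_recl // [X in _ = X + _]fps_sum_nat_recl // -addrA.
have iE : i.+1%:Z - j%:Z = i%:Z - j%:Z + 1 by lia.
congr (_ + _).
  by rewrite /jt_term !binz0; congr (_ * _ * G_row _ _); lia.
rewrite -fps_sumD; first last.
- exact: summableMl.
- move=> d; apply: sub_finite_set (finite_preimage _ (sjt i j (m - 1) p d)).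
    by move=> s /= Fs; exact: Fs.
  by move=> s t _ _ [].
congr fps_sum; apply/funext => s.
rewrite /jt_term iE binzS rmorphD /=.
have -> : m + j%:Z - i.+1%:Z + s.+1%:Z = m + j%:Z - i%:Z + s%:Z by lia.
have -> : m - 1 + j%:Z - i%:Z + s.+1%:Z = m + j%:Z - i%:Z + s%:Z by lia.
by rewrite exprS; ring.
Qed.

(** Rests on [(1 + beta x) - (1 - x u) = x (u + beta)]: the change caused by raising the flag
    becomes a multiple of an entry with the next row number. *)
Lemma jt_entry_flag_step i j m p :
  (1 + beta * xvar p.+1) * (jt_entry i j m p.+1 - jt_entry i j m p) =
  xvar p.+1 * jt_entry i.+1 j m p.+1.
Proof. by rewrite mulrBr -jt_entry_recr jt_entry_pascal; ring. Qed.

Lemma jt_entry_diag i m p : jt_entry i i m p = G_row p m.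
Proof.
rewrite jt_entry.unlock (fps_sum1 (k0 := 0%N)) /jt_term subrr.
  by rewrite binz0 expr0 !mul1r addrK addr0.
by move=> s; rewrite binz0n; case: s => // s _; rewrite !mul0r.
Qed.

(** For [j < i] the exponent [i - j - 1] of [u + beta] is nonnegative, so the generating series has
    only positive powers of [u]. The induction starts at [i = j.+1], where [G_row_neg] gives the
    cancellation. *)
Lemma jt_entry_lower i j m p : (j < i)%N -> m <= 0 -> jt_entry i j m p = 0.
Proof.
elim: i m => // i IH m; rewrite ltnS leq_eqVlt => /predU1P[->|ji] m0.
  rewrite jt_entry_pascal !jt_entry_diag G_row_neg; last by lia.
  by rewrite subrK; ring.
by rewrite jt_entry_pascal !IH //; [ring|lia].
Qed.

(** Without variables only the indices at most 0 survive in [G_row], whereas in row 0 every index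
    [m + j + s] is positive. *)
Lemma jt_entry_row0 j m : 0 < m -> jt_entry 0 j m 0 = 0.
Proof.
move=> m0; rewrite jt_entry.unlock (fps_sum1 (k0 := 0%N)).
all: rewrite /jt_term ?G_row_flag0 /u_inv_factor.
  by rewrite ifF ?mulr0 //; apply/negbTE; lia.
by move=> s _; rewrite G_row_flag0 /u_inv_factor ifF ?mulr0 //; apply/negbTE; lia.
Qed.

(** * The determinant *)

Lemma det_row_sum (R : comNzRingType) n (M : finType) (C : 'I_n -> M -> R)
    (F : 'I_n -> M -> 'I_n -> R) :
  \det (\matrix_(i < n, j < n) \sum_m C i m * F i m j) =
  \sum_(mu : {ffun 'I_n -> M})
    (\prod_i C i (mu i)) * \det (\matrix_(i < n, j < n) F i (mu i) j).
Proof.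
rewrite /determinant.
under [RHS]eq_bigr => mu _ do rewrite mulr_sumr.
rewrite exchange_big; apply: eq_bigr => s _.
under [in LHS]eq_bigr => i _ do rewrite mxE.
rewrite bigA_distr_bigA mulr_sumr; apply: eq_bigr => mu _.
rewrite big_split mulrCA; congr (_ * (_ * _)).
by apply: eq_bigr => i _; rewrite mxE.
Qed.

(** [B] is [(1 - V) A], and [1 - V] is upper unitriangular. *)
Lemma det_addl_upper (R : comNzRingType) n (A B V : 'M[R]_n) :
  (forall i k : 'I_n, (k <= i)%N -> V i k = 0) -> A - B = V *m A -> \det A = \det B.
Proof.
move=> V0 AB.
have -> : B = (1%:M - V) *m A.
  by rewrite mulmxBl mul1mx -AB opprB addrC subrK.
rewrite det_mulmx -[\det (1%:M - V)]det_tr det_trig.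
  rewrite big1 ?mul1r // => i _.
  by rewrite !mxE eqxx V0 // subr0.
apply/is_trig_mxP => i j ij; rewrite !mxE V0 ?subr0; last exact: ltnW.
by case: eqP => // ji; rewrite ji ltnn in ij.
Qed.

Lemma sum_strip_coef_diag (c l : nat) x (F : nat -> Zbx) : (l <= c)%N ->
  \sum_(m < c.+1) strip_coef beta x l l m * F m = F l.
Proof.
move=> lc; rewrite (bigD1 (inord l)) //= big1 => [|m].
  rewrite /strip_coef inordK ?ltnS // leqnn subnn expr0 ltnn mulr0n !addr0.
  by rewrite !mul1r.
rewrite -val_eqE /= inordK ?ltnS // => ml.
by rewrite /strip_coef -eqn_leq eq_sym (negbTE ml) mul0r.
Qed.

(** One more cell in the row is one more lost cell, hence a factor [x], whenever [m <= l]; the only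
    new term is [m = l.+1], where no cell is lost. *)
Lemma sum_strip_coefS (c l l' : nat) x (F : nat -> Zbx) :
  (l' <= l)%N -> (l < c)%N ->
  \sum_(m < c.+1) strip_coef beta x l.+1 l' m * F m =
  x * (\sum_(m < c.+1) strip_coef beta x l l' m * F m) + (1 + beta * x) * F l.+1.
Proof.
move=> l'l lc; rewrite [LHS](bigD1 (inord l.+1)) //= mulr_sumr.
rewrite [X in _ = X + _](bigD1 (inord l.+1)) //= !inordK ?ltnS // addrC.
congr (_ + _); last first.
  by rewrite /strip_coef leqnn leqW // ltnS l'l subnn expr0 mul1r.
rewrite {2}/strip_coef ltnn andbF mul0r mulr0 add0r.
apply: eq_bigr => m; rewrite -val_eqE /= inordK ?ltnS // => ml.
rewrite /strip_coef [(m <= l.+1)%N]leq_eqVlt (negbTE ml) /= ltnS.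
case: ifP => [/andP[_ ml']|_]; last by rewrite mul0r mulr0.
by rewrite subSn // exprS !mulrA.
Qed.

(** Induction on [l - l']. At [l = l'] this is [jt_entry_flag_step] divided by [1 + beta x], whose
    inverse is here called [w]; from [l] to [l.+1] the recurrences [jt_entry_recr] and
    [sum_strip_coefS] match. *)
Lemma jt_entry_strip i j (c l l' p : nat) w :
    (l' <= l <= c)%N -> w * (1 + beta * xvar p.+1) = 1 ->
  jt_entry i j l p.+1 =
  \sum_(m < c.+1) strip_coef beta (xvar p.+1) l l' m * jt_entry i j (val m) p +
  xvar p.+1 ^+ (l - l') * (xvar p.+1 * w) * jt_entry i.+1 j l' p.+1.
Proof.
move=> /andP[l'l] + w1; rewrite -(subnK l'l).
elim: (l - l')%N => [|d IH] lc.
  rewrite add0n subnn expr0 mul1r.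
  rewrite (sum_strip_coef_diag _ (fun m => jt_entry i j m p)) //.
  rewrite -mulrA mulrCA -jt_entry_flag_step mulrA w1 mul1r; ring.
rewrite addSn (sum_strip_coefS _ (fun m => jt_entry i j m p)) ?leq_addl //.
have -> : ((d + l').+1 - l' = (d + l' - l').+1)%N by lia.
rewrite -jt_entry_recr.
have -> : (d + l').+1%:Z - 1 = (d + l')%N by lia.
by rewrite (IH (ltnW lc)) exprS; ring.
Qed.

(** * Recursion of the determinant in the largest flag value *)

Definition jt_det r (la g : nat -> nat) : Zbx :=
  \det (\matrix_(i < r, j < r) jt_entry i j (la i) (g i)).

Lemma jt_det_step r c p (la g : nat -> nat) :
    (forall i, la i.+1 <= la i <= c)%N -> la r = 0%N ->
    (forall i, g i <= p.+1)%N -> (forall i, (i.+1 < r)%N -> (g i <= g i.+1)%N) ->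
  jt_det r la g =
  \sum_(mu : {ffun 'I_r -> 'I_c.+1})
    (\prod_(i < r) row_coef beta (p < g i)%N (xvar p.+1) (la i) (la i.+1) (mu i)) *
    \det (\matrix_(i < r, j < r) jt_entry i j (mu i : nat) (minn (g i) p)).
Proof.
move=> la_dec la_r gp g_inc.
rewrite -(det_row_sum
  (fun i m => row_coef beta (p < g i)%N (xvar p.+1) (la i) (la i.+1) (val m))
  (fun i (m : 'I_c.+1) (j : 'I_r) => jt_entry i j (val m) (minn (g i) p))).
have [w w1] := one_plus_beta_xvar_inv p.+1.
(* [V] collects the multiples of the next row supplied by [jt_entry_strip], for the rows of flag
   [p.+1]. *)
pose V := \matrix_(i < r, k < r) (if (p < g i)%N && (k == i.+1 :> nat)
  then xvar p.+1 ^+ (la i - la i.+1) * (xvar p.+1 * w) else 0).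
apply: (@det_addl_upper _ _ _ _ V) => [i k ki|].
  by rewrite mxE ifF // (@ltn_eqF k i.+1) ?andbF.
apply/matrixP => i j; rewrite !mxE.
under [in RHS]eq_bigr => k _ do rewrite !mxE.
rewrite /row_coef; have [gi|gi] := ltnP p (g i); last first.
  rewrite [RHS]big1 => [|k _]; last by rewrite mul0r.
  rewrite (bigD1 (inord (la i))) //= big1 ?addr0 => [|m].
    have := la_dec i => /andP[_ lac].
    by rewrite inordK ?ltnS // eqxx mul1r subrr.
  have := la_dec i => /andP[_ lac].
  by rewrite -val_eqE /= inordK ?ltnS // => /negbTE ->; rewrite mul0r.
have {}gi : g i = p.+1 by apply/eqP; rewrite eqn_leq gp gi.
rewrite gi (jt_entry_strip _ _ (la_dec i) w1) addrC addKr /=.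
(* Flags increase, so the next row also has flag [p.+1] and the remainder is a multiple of that row.
   Below the last row it vanishes by [jt_entry_lower], as [la r = 0]. *)
have [ir|ir] := ltnP i.+1 r.
  rewrite (bigD1 (Ordinal ir)) //= eqxx big1 ?addr0 => [|k].
    by have := g_inc i ir; have := gp i.+1;
    rewrite gi => ? ?; congr (_ * jt_entry _ _ _ _); lia.
  by rewrite -val_eqE /= => /negbTE ->; rewrite mul0r.
have -> : i.+1 = r by apply/eqP; rewrite eqn_leq ir ltn_ord.
rewrite la_r jt_entry_lower ?ltn_ord // mulr0 big1 // => k _.
by rewrite (ltn_eqF (ltn_ord k)) mul0r.
Qed.

(** For the empty shape the matrix is upper unitriangular; for any other its first row is zero. *)
Lemma jt_det_zero r c (la g : nat -> nat) :
    (forall i, la i.+1 <= la i <= c)%N -> (forall i, g i = 0)%N ->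
  jt_det r la g = [forall i : 'I_r, la i == 0%N]%:R.
Proof.
move=> la_dec g0; rewrite /jt_det; case: forallP => [la0|nla0] /=.
  rewrite -det_tr det_trig.
    rewrite big1 // => i _; rewrite !mxE (eqP (la0 i)) jt_entry_diag.
    exact: G_row_eq1.
  apply/is_trig_mxP => i j ij; rewrite !mxE (eqP (la0 j)).
  exact: jt_entry_lower.
case: r nla0 => [|r] nla0; first by case: nla0 => -[].
have la_0 : (0 < la 0)%N.
  rewrite lt0n; apply/eqP => la_0; apply: nla0 => i.
  suff: (la i <= la 0)%N by rewrite la_0 leqn0.
  elim: (val i) => // k; apply: leq_trans.
  by have /andP[] := la_dec k.
rewrite (expand_det_row _ ord0) big1 // => j _.
by rewrite !mxE g0 jt_entry_row0 ?mul0r.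
Qed.

(** * Comparison of tableau sums and determinants *)

Lemma eq_tableau_sum (R : comNzRingType) (b : R) (x : nat -> R) r c N
    (L : {set 'I_r * 'I_c}) (g g' : nat -> nat) :
  (forall i, (i < r)%N -> g i = g' i) ->
  tableau_sum b x N L g = tableau_sum b x N L g'.
Proof.
move=> gg'; apply: eq_bigl => T; congr (_ && _).
apply/semistandardP/semistandardP => -[T1 T2 T3]; split => // u k /T1.
  by rewrite gg'.
by rewrite gg'.
Qed.

Lemma tableau_sum_flag0 (R : comNzRingType) (b : R) (x : nat -> R) r c N
    (L : {set 'I_r * 'I_c}) (g : nat -> nat) : (forall i, g i = 0)%N ->
  tableau_sum b x N L g = (L == finset.set0)%:R.
Proof.
move=> g0; pose T0 : {ffun 'I_r * 'I_c -> {set 'I_N}} := [ffun=> finset.set0].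
have occ0 : occupied T0 = finset.set0.
  by apply/setP => u; rewrite !finset.inE ffunE eqxx.
rewrite /tableau_sum big_mkcond (bigD1 T0) //= big1 => [|T TT0].
  rewrite occ0 eq_sym addr0.
  have -> : semistandard g T0.
    by apply/semistandardP;
      split => [u k|u v _ k l|u v _ k l]; rewrite ffunE finset.inE.
  case: eqP => // _; rewrite /weight big1 // => u _.
  by rewrite ffunE /box_weight cards0 big_set0 expr0 mul1r.
case: ifP => // /andP[/semistandardP[T1 _ _] _]; case/eqP: TT0.
apply/ffunP => u; rewrite ffunE; apply/setP => k; rewrite [RHS]finset.inE.
by apply/negP => /T1; rewrite g0; lia.
Qed.

Lemma strip_coef_neq0 (R : comNzRingType) (b y : R) l l' m :
  strip_coef b y l l' m != 0 -> (l' <= m <= l)%N.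
Proof. by rewrite /strip_coef; case: ifP; rewrite ?eqxx. Qed.

Lemma row_coef_neq0 (R : comNzRingType) (b y : R) t l l' m : (l' <= l)%N ->
  row_coef b t y l l' m != 0 -> (l' <= m <= l)%N.
Proof.
move=> l'l; rewrite /row_coef; case: t; first exact: strip_coef_neq0.
by have [->|_] := eqVneq m l; rewrite ?l'l ?leqnn ?eqxx.
Qed.

(** Induction on the cap [p] of the flags, for all shapes at once, because one step passes from [la]
    to the interlacing shapes. *)
Lemma tableau_sum_jt_det r c N (f : nat -> nat) (p : nat) (la : nat -> nat) :
    (p < N)%N -> (forall i, (i.+1 < r)%N -> (f i <= f i.+1)%N) ->
    (forall i, la i.+1 <= la i <= c)%N -> la r = 0%N ->
  tableau_sum beta xvar N (diagram c (fun i : 'I_r => la i)) (fun i => minn (f i) p) =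
  jt_det r la (fun i => minn (f i) p).
Proof.
elim: p la => [|p IH] la pN f_inc la_dec la_r.
  have f0 i : minn (f i) 0 = 0%N by rewrite minn0.
  rewrite tableau_sum_flag0 // (jt_det_zero _ la_dec) //; congr (nat_of_bool _)%:R.
  apply/eqP/forallP => [la0 i|la0].
    case laE: (la i) => [//|k].
    have c0 : (0 < c)%N by have /andP[_] := la_dec i; rewrite laE; apply: leq_trans.
    have : (i, Ordinal c0) \in diagram c (fun i : 'I_r => la i).
      by rewrite finset.inE /= laE.
    by rewrite la0 finset.inE.
  by apply/setP => u; rewrite !finset.inE (eqP (la0 u.1)).
have gp i : (minn (f i) p.+1 <= p.+1)%N by rewrite geq_minr.
have ming i : minn (minn (f i) p.+1) p = minn (f i) p by lia.
rewrite (jt_det_step la_dec la_r gp); last first.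
  by move=> i /f_inc; lia.
rewrite (@tableau_sum_diagram _ _ _ _ _ _ _ (Ordinal pN)) //=.
apply: eq_bigr => mu _.
set C := (X in _ = X * _); rewrite -[LHS]/(C * _).
(* Where the coefficient vanishes, [mu] need not be a partition and the induction hypothesis may not
   apply. *)
have [->|cmu] := eqVneq C 0.
  by rewrite !mul0r.
congr (_ * _).
rewrite (@eq_tableau_sum _ _ _ _ _ _ _ _ (fun i => minn (f i) p));
  last by move=> i _; exact: ming.
(* The induction hypothesis takes a sequence on all of [nat], so [mu] is continued by 0. *)
pose nu k := if insub k is Some i then nat_of_ord (mu (i : 'I_r)) else 0%N.
have nuE (i : 'I_r) : nu i = mu i by rewrite /nu valK.
have nu_out k : (r <= k)%N -> nu k = 0%N.
  by move=> rk; rewrite /nu insubF // ltnNge rk.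
have mu_bound (i : 'I_r) : (la i.+1 <= nu i <= la i)%N.
  rewrite nuE; have /andP[la_i _] := la_dec i.
  apply: (@row_coef_neq0 _ beta (xvar p.+1) (p < minn (f i) p.+1)%N _ _ _ la_i).
  apply: contraNneq cmu => ci.
  by rewrite /C (bigD1 i) //= ci mul0r.
have nu_la k : (nu k <= la k)%N.
  have [kr|/nu_out -> //] := ltnP k r.
  by have /andP[] := mu_bound (Ordinal kr).
transitivity (tableau_sum beta xvar N (diagram c (fun i : 'I_r => nu i))
   (fun i => minn (f i) p)).
  by congr tableau_sum; apply/setP => u; rewrite !finset.inE nuE.
(* Interlacing gives [nu k.+1 <= la k.+1 <= nu k]. *)
have nu_dec k : (nu k.+1 <= nu k <= c)%N.
  apply/andP; split.
    have [kr|rk] := ltnP k r; last by rewrite nu_out // leqW.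
    have /andP[la_nu _] := mu_bound (Ordinal kr).
    exact: leq_trans (nu_la _) la_nu.
  by apply: leq_trans (nu_la k) _; have /andP[] := la_dec k.
rewrite (IH nu (ltnW pN) f_inc nu_dec (nu_out r (leqnn r))).
by congr (\det _); apply/matrixP => i j; rewrite !mxE nuE ming.
Qed.

(** * Fillings of a Young diagram and of a rectangular grid *)

Lemma set_max_ge n (A : {set 'I_n}) k : k \in A -> (k <= set_max A)%N.
Proof. by move=> kA; apply: (leq_bigmax_cond k). Qed.

Lemma set_min_le n (A : {set 'I_n}) k : k \in A -> (set_min A <= k)%N.
Proof.
move=> kA; rewrite /set_min; have: k \in index_enum 'I_n by rewrite mem_index_enum.
elim: (index_enum _) => // i s IH; rewrite inE big_cons => /predU1P[<-|/IH ks].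
  by rewrite kA geq_minl.
by case: ifP => // _; apply: leq_trans ks; apply: geq_minr.
Qed.

Lemma set_max_mem n (A : {set 'I_n}) : A != finset.set0 ->
  exists2 k, k \in A & set_max A = k.
Proof.
rewrite -card_gt0 => A0.
have [k kA kE] := eq_bigmax_cond (fun k : 'I_n => nat_of_ord k) A0.
by exists k.
Qed.

Lemma set_min_mem n (A : {set 'I_n}) : A != finset.set0 ->
  exists2 k, k \in A & set_min A = k.
Proof.
move=> /set0Pn[k0 k0A].
(* The second case is the default value [n], excluded because [A] has an element and all elements
   are below [n]. *)
have [//|minn_n] : (exists2 k, k \in A & set_min A = k) \/ set_min A = n.
  rewrite /set_min;
  apply: (big_ind (fun m : nat => (exists2 k, k \in A & m = k) \/ m = n)).
  - by right.
  - by move=> m1 m2; rewrite /minn; case: ifP.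
  - by move=> k kA; left; exists k.
by have := set_min_le k0A; rewrite minn_n leqNgt ltn_ord.
Qed.

Lemma set_max_le_min n (A B : {set 'I_n}) : A != finset.set0 -> B != finset.set0 ->
  reflect (forall k l, k \in A -> l \in B -> (k <= l)%N) (set_max A <= set_min B)%N.
Proof.
move=> A0 B0; apply: (iffP idP) => [AB k l kA lB|AB].
  exact: leq_trans (set_max_ge kA) (leq_trans AB (set_min_le lB)).
by have [k kA ->] := set_max_mem A0; have [l lB ->] := set_min_mem B0; apply: AB.
Qed.

Lemma set_max_lt_min n (A B : {set 'I_n}) : A != finset.set0 -> B != finset.set0 ->
  reflect (forall k l, k \in A -> l \in B -> (k < l)%N) (set_max A < set_min B)%N.
Proof.
move=> A0 B0; apply: (iffP idP) => [AB k l kA lB|AB].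
  exact: leq_ltn_trans (set_max_ge kA) (leq_trans AB (set_min_le lB)).
by have [k kA ->] := set_max_mem A0; have [l lB ->] := set_min_mem B0; apply: AB.
Qed.

Section Boxes.
Variables la f : seq nat.
Notation cell := ('I_(size la) * 'I_(head 0%N la))%type.
Notation value := 'I_(last 0%N f).+1.
Notation young := (diagram (head 0%N la) (fun i : 'I_(size la) => nth 0%N la i)).

Definition extend (T : filling la f) : {ffun cell -> {set value}} :=
  [ffun u => if insub u is Some v then T (v : box la) else finset.set0].

Definition restrict (U : {ffun cell -> {set value}}) : filling la f :=
  [ffun v : box la => U (val v)].

Lemma extend_box T (v : box la) : extend T (val v) = T v.
Proof. by rewrite ffunE valK. Qed.

Lemma extendK : cancel extend restrict.
Proof. by move=> T; apply/ffunP => v; rewrite ffunE extend_box. Qed.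

Lemma young_box (u : cell) : u \in young -> exists v : box la, val v = u.
Proof. by rewrite finset.inE => ub; exists (Sub u ub); rewrite SubK. Qed.

Lemma box_young (v : box la) : val v \in young.
Proof. by rewrite finset.inE; exact: (valP v). Qed.

Lemma extend_out T (u : cell) : u \notin young -> extend T u = finset.set0.
Proof. by rewrite finset.inE => ub; rewrite ffunE insubN. Qed.

Lemma restrictK (U : {ffun cell -> {set value}}) :
  occupied U = young -> extend (restrict U) = U.
Proof.
move=> UY; apply/ffunP => u; have [/young_box[v <-]|uY] := boolP (u \in young).
  by rewrite extend_box ffunE.
rewrite extend_out //; apply/esym/eqP; apply: contraNT uY.
by rewrite -UY finset.inE.
Qed.

(** Non-emptiness of the boxes becomes the condition on [occupied]; it also turns comparisons of
    maxima and minima into comparisons of all pairs of entries, while the cells outside the diagram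
    impose nothing. *)
Lemma is_fsvtE (T : filling la f) :
  is_fsvt T = semistandard (nth 0%N f) (extend T) && (occupied (extend T) == young).
Proof.
have memE u k : k \in extend T u -> exists2 v : box la, val v = u & k \in T v.
  have [/young_box[v <-]|uY] := boolP (u \in young).
    by rewrite extend_box; exists v.
  by rewrite extend_out // finset.inE.
apply/and3P/andP => [[/forallP T1 /forallP T2 /forallP T3]|[]].
  have T0 v : T v != finset.set0 by have /andP[] := T1 v.
  split.
    apply/semistandardP; split.
    - by move=> u k /memE[v <- kT]; have /andP[_ /forall_inP] := T1 v; apply.
    - move=> u u' uu' k l /memE[v vu kT] /memE[v' vu' lT].
      move: uu'; rewrite -vu -vu' => /andP[/eqP r1 c1].
      have /implyP := forallP (T2 v) v'.
      rewrite /box_row /box_col r1 eqxx c1 => /(_ isT).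
      by move=> /(set_max_le_min (T0 v) (T0 v')); apply.
    - move=> u u' uu' k l /memE[v vu kT] /memE[v' vu' lT].
      move: uu'; rewrite -vu -vu' => /andP[r1 /eqP c1].
      have /implyP := forallP (T3 v) v'.
      rewrite /box_row /box_col c1 eqxx r1 => /(_ isT).
      by move=> /(set_max_lt_min (T0 v) (T0 v')); apply.
  apply/eqP/setP => u; rewrite [LHS]finset.inE.
  have [/young_box[v <-]|uY] := boolP (u \in young); first by rewrite extend_box T0.
  by rewrite extend_out // eqxx.
move=> /semistandardP[T1 T2 T3] /eqP TY.
have T0 v : T v != finset.set0.
  by have := box_young v; rewrite -TY finset.inE extend_box.
split; apply/forallP => v.
- rewrite T0; apply/forall_inP => k kT; apply: (T1 (val v)).
  by rewrite extend_box.
- apply/forallP => v'; apply/implyP => /andP[r1 c1].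
  apply/(set_max_le_min (T0 v) (T0 v')) => k l kT lT.
  by apply: (T2 (val v) (val v')); rewrite ?extend_box //; apply/andP.
- apply/forallP => v'; apply/implyP => /andP[r1 c1].
  apply/(set_max_lt_min (T0 v) (T0 v')) => k l kT lT.
  by apply: (T3 (val v) (val v')); rewrite ?extend_box //; apply/andP.
Qed.

Lemma prod_young (R : comNzRingType) (F : cell -> R) :
    (forall u, u \notin young -> F u = 1) ->
  \prod_u F u = \prod_(v : box la) F (val v).
Proof.
move=> F1; rewrite (bigID (mem young)) /= [X in _ * X]big1 // mulr1.
rewrite (@reindex_omap _ _ _ _ (box la) (fun v : box la => val v) insub) =>
  [|u uY]; last first.
  by rewrite insubT //; move: uY; rewrite finset.inE.
by apply: eq_bigl => v; rewrite box_young valK eqxx.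
Qed.

Lemma card_box : (forall i, nth 0%N la i <= head 0%N la)%N -> #|{: box la}| = sumn la.
Proof.
move=> la_head; rewrite card_sub -sum1_card.
under eq_bigl => u do rewrite inE.
rewrite -(pair_big_dep xpredT (fun (i : 'I_(size la)) (j : 'I_(head 0%N la)) =>
  (j < nth 0%N la i)%N) (fun _ _ => 1%N)) /=.
rewrite sumnE (big_nth 0%N) big_mkord; apply: eq_bigr => i _.
by rewrite (big_ord_narrow (la_head i)) sum_nat_const card_ord muln1.
Qed.

Lemma G_flagged_tableau_sum : (forall i, nth 0%N la i <= head 0%N la)%N ->
  G_flagged la f = tableau_sum beta xvar (last 0%N f).+1 young (nth 0%N f).
Proof.
move=> la_head; rewrite /tableau_sum (reindex_onto extend restrict) /=; last first.
  by move=> U /andP[_ /eqP]; apply: restrictK.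
rewrite /G_flagged; apply: eq_big => [T|T].
  by rewrite extendK eqxx andbT is_fsvtE.
rewrite is_fsvtE => /andP[_ /eqP TY].
rewrite /weight prod_young => [|u uY]; last first.
  by rewrite extend_out // /box_weight cards0 big_set0 expr0 mul1r.
under [RHS]eq_bigr => v _ do rewrite extend_box.
rewrite /box_weight big_split; congr (_ * _).
(* No box is empty, so the exponents [#|T v|.-1] add up to the number of entries minus the number of
   boxes. *)
rewrite prodrXr; congr (_ ^+ _).
have T0 v : (0 < #|T v|)%N.
  by rewrite card_gt0; have := box_young v; rewrite -TY finset.inE extend_box.
rewrite /num_entries -card_box // -sum1_card.
apply/eqP; rewrite -(eqn_add2r (\sum_(v : box la) 1)) subnK.
  by rewrite -big_split /=; apply/eqP/eq_bigr => v _; rewrite addn1 prednK.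
exact: leq_sum.
Qed.

End Boxes.

(** * Polynomiality and conclusion *)

Lemma G_flagged_polynomial la f :
  exists P : {malg {poly int}[{cmonom nat}]}, G_flagged la f = fps_of_malg P.
Proof.
pose poly (F : Zbx) := exists P : {malg {poly int}[{cmonom nat}]}, F = fps_of_malg P.
have polyD F G : poly F -> poly G -> poly (F + G).
  by move=> [P ->] [Q ->]; exists (P + Q); apply: fpsP => m /=; rewrite mcoeffD.
have poly0 : poly 0 by exists 0; apply: fpsP => m /=; rewrite mcoeff0.
have polyM F G : poly F -> poly G -> poly (F * G).
  by move=> [P ->] [Q ->]; exists (P * Q); apply: fpsP => m; apply: fps_mulE.
have polyC c : poly (fps_cst c).
  by exists (c%:MP); apply: fpsP => m /=; rewrite mcoeffC; case: eqP.
have poly1 : poly 1 by apply: polyC.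
have polyX k : poly (xvar k).
  exists << ucm k.-1 >>; apply: fpsP => m /=; rewrite mcoeffU eq_sym.
  by case: eqP.
have poly_beta n : poly (beta ^+ n).
  by elim: n => [|n IH]; rewrite ?expr0 // exprS; apply: (polyM) => //; apply: polyC.
rewrite -/(poly _); apply: (big_ind poly poly0 polyD) => T _; apply: (polyM) => //.
by apply: (big_ind poly poly1 polyM) => v _; apply: (big_ind poly poly1 polyM).
Qed.

Theorem theorem2p8 (la f : seq nat)
    (la_part : is_partition la) (f_flag : is_flagging la f)
    (f_std : (1 < size la)%N -> nth 0%N f 0 = 1%N -> (1 < nth 0%N f 1)%N) :
  G_flagged la f = G_tilde la f /\
  exists P : {malg {poly int}[{cmonom nat}]}, G_tilde la f = fps_of_malg P.
Proof.
have /andP[la_sorted _] := la_part.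
have /and3P[/eqP size_f f_sorted _] := f_flag.
have la_dec i : (nth 0%N la i.+1 <= nth 0%N la i)%N.
  have [il|il] := ltnP i.+1 (size la); last by rewrite (nth_default _ il).
  by have /(sortedP 0%N) := la_sorted; apply.
have la_head i : (nth 0%N la i <= head 0%N la)%N.
  rewrite -nth0; elim: i => // i; exact: leq_trans.
have f_inc i : (i.+1 < size la)%N -> (nth 0%N f i <= nth 0%N f i.+1)%N.
  by rewrite -size_f; move/(sortedP 0%N): f_sorted; apply.
have f_last i : (nth 0%N f i <= last 0%N f)%N.
  have [il|il] := ltnP i (size f); last by rewrite nth_default.
  rewrite -nth_last; apply: (sorted_leq_nth leq_trans leqnn) => //.
  - by rewrite inE prednK // (leq_trans _ il).
  - by rewrite -ltnS prednK // (leq_trans _ il).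
(* The last flag is the largest, so capping by it changes nothing; the recursion is entered at this
   cap. *)
have min_last i : nth 0%N f i = minn (nth 0%N f i) (last 0%N f).
  by have := f_last i; lia.
have eqG : G_flagged la f = G_tilde la f.
  rewrite G_flagged_tableau_sum //.
  rewrite (eq_tableau_sum _ _ _ _ (fun i _ => min_last i)).
  have la_dec_head i : (nth 0%N la i.+1 <= nth 0%N la i <= head 0%N la)%N.
    by rewrite la_dec la_head.
  have la_size : nth 0%N la (size la) = 0%N by rewrite nth_default.
  rewrite (tableau_sum_jt_det (ltnSn _) f_inc la_dec_head la_size).
  congr (\det _); apply/matrixP => i j; rewrite !mxE -min_last.
  by rewrite jt_entry.unlock.
by split; rewrite -?eqG //; apply: G_flagged_polynomial.
Qed.
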